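(* Let $\mathbb{F}_q$ be a finite field. There is, up to equivalence, only one sigma-cyclic rational code over $\mathbb{F}_q$ of a given length and dimension of the form $C_{\mathcal L}(D,rP_\beta)$, where $D=P_{\alpha_1}+\cdots+P_{\alpha_n}$ is the divisor coming from an orbit, $1\le r\le n-2$ and $\beta\in\mathbb{P}^1(\mathbb{F}_q)$. That is: let $A,A'\in \mathrm{PGL}_2(\mathbb{F}_q)$ be matrices of orders $n$ and $n'$, let $\alpha,\beta,\alpha',\beta'\in\mathbb{P}^1(\mathbb{F}_q)$ satisfy $A^{-1}\cdot\alpha\neq\alpha$, $A^{-1}\cdot\beta=\beta$, $A'^{-1}\cdot\alpha'\neq\alpha'$, $A'^{-1}\cdot\beta'=\beta'$, and let $1\le r\le n-2$, $1\le r'\le n'-2$ be integers. If the codes $\mathcal{C}(A,\alpha,\beta,r)$ and $\mathcal{C}(A',\alpha',\beta',r')$ have the same length and the same dimension, then they are equivalent.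
   Context: For a function field $F$ over $\mathbb{F}_q$ (a finite extension of a rational function field $\mathbb{F}_q(x)$ with full constant field $\mathbb{F}_q$), distinct rational (degree one) places $P_1,\dots,P_n$ of $F$, $D=P_1+\cdots+P_n$ and a divisor $G$ with support disjoint from that of $D$, the AG-code is $C_{\mathcal L}(D,G)=\{(z(P_1),\ldots,z(P_n))\in\mathbb{F}_q^n : z\in\mathcal{L}(G)\}$, where $z(P_i)$ is the residue class of $z$ modulo $P_i$ and $\mathcal{L}(G)=\{z\in F^*:(z)\ge -G\}\cup\{0\}$. In $\mathbb{F}_q(x)$, $P_\alpha$ ($\alpha\in\mathbb{F}_q$) denotes the zero of $x-\alpha$ and $P_\infty$ the pole of $x$; $\mathbb{P}^1(\mathbb{F}_q)=\mathbb{F}_q\cup\{\infty\}$, and $\mathrm{PGL}_2(\mathbb{F}_q)$ acts on it by fractional linear transformations $\left(\begin{smallmatrix} a&b\\c&d\end{smallmatrix}\right)\cdot\alpha=\frac{a\alpha+b}{c\alpha+d}$. Given $A\in\mathrm{PGL}_2(\mathbb{F}_q)$ of order $n$, $\alpha,\beta\in\mathbb{P}^1(\mathbb{F}_q)$ with $A^{-1}\cdot\alpha\ne\alpha$ and $A^{-1}\cdot\beta=\beta$, and an integer $1\le r\le n-2$, put $\alpha_1=\alpha$, $\alpha_{i+1}=A^{-1}\cdot\alpha_i$ for $1\le i\le n-1$ (these are $n$ distinct elements, forming the orbit of $\alpha$ under $A^{-1}$). Then $\mathcal{C}(A,\alpha,\beta,r)$ denotes the code $C_{\mathcal L}(D,G)$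 over $\mathbb{F}_q$ with $D=P_{\alpha_1}+\cdots+P_{\alpha_n}$ and $G=rP_\beta$. These are the sigma-cyclic rational codes considered. Two codes $\mathcal{C}_1,\mathcal{C}_2\subseteq\mathbb{F}_q^n$ are equivalent if $\mathcal{C}_2=\mathcal{C}_1M$ for some monomial matrix $M$ over $\mathbb{F}_q$ (a matrix with exactly one nonzero entry in each row and each column). *)

(* Defs.v *)
From HB Require Import structures.
From mathcomp Require Import all_boot all_order all_fingroup all_algebra.
From mathcomp Require Import all_solvable.
From mathcomp Require Import boolp classical_sets.
From mathcomp Require Import freeg.

Set Implicit Arguments.
Unset Strict Implicit.
Unset Printing Implicit Defensive.

Import GRing.Theory.

Local Open Scope ring_scope.

Lemma tofrac_ex (R : idomainType) (z : {fraction R}) : exists f g : R,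
    g != 0 /\ z = tofrac f / tofrac g.
Proof.
elim/quotW: z => r; exists (frac r).1, (frac r).2.
split; first exact: denom_ratioP.
apply: (@mulIf _ (tofrac (frac r).2)).
  by rewrite tofrac_eq0 denom_ratioP.
rewrite divfK ?tofrac_eq0 ?denom_ratioP //.
unlock tofrac; rewrite -[LHS]FracField.pi_mul.
apply/eqmodP; rewrite /= FracField.equivfE /FracField.mulf.
by rewrite !numden_Ratio ?oner_eq0 ?mulr1 ?denom_ratioP // mulrC.
Qed.

Section RationalFunctionField.
Variable F : finFieldType.

Notation ratfun := {fraction {poly F}}.

Definition rat_const (a : F) : ratfun := tofrac a%:P.
Definition rat_x : ratfun := tofrac 'X.

Definition valuation_ring (O : {pred ratfun}) : Prop :=
  [/\ subring_closed O,
      (forall a, rat_const a \in O),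
      (exists2 z, z \in O & forall a, z != rat_const a),
      (exists z, z \notin O) &
      (forall z, z != 0 -> z \in O \/ z^-1 \in O)].

(* A place is the maximal ideal of a valuation ring; as either of the two     *)
(* determines the other, it is represented by its valuation ring.             *)
Record place := Place {
  place_ring : {pred ratfun};
  place_ringP : valuation_ring place_ring }.

HB.instance Definition _ := gen_eqMixin place.
HB.instance Definition _ := gen_choiceMixin place.

Definition place_unit (P : place) : {pred ratfun} :=
  [pred z | [&& z != 0, z \in place_ring P & z^-1 \in place_ring P]].

Definition place_ideal (P : place) : {pred ratfun} :=
  [pred z | (z \in place_ring P) && (z \notin place_unit P)].

Definition prime_element (P : place) (t : ratfun) : Prop :=
  forall z, z \in place_ideal P <->
    exists2 w, w \in place_ring P & z = t * w.

(* v_P(z) for z != 0: the m such that z = t ^ m * u with t a prime element    *)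
(* and u a unit at P. The value at z = 0 is irrelevant.                       *)
Definition place_val (P : place) (z : ratfun) : int :=
  xget 0 [set m : int | exists t u,
    [/\ prime_element P t, u \in place_unit P & z = t ^ m * u]]%classic.

(* z(P) for z regular at a rational place P: the unique constant a such that  *)
(* z - a lies in P.                                                           *)
Definition place_eval (P : place) (z : ratfun) : F :=
  odflt 0 [pick a : F | z - rat_const a \in place_ideal P].

Definition divisor := {freeg place / int}.

Definition riemann_roch_space (G : divisor) (z : ratfun) : Prop :=
  z = 0 \/ (z != 0 /\ forall P : place, - coeff P G <= place_val P z).

(* C_L(D, G) with D = P_0 + ... + P_(n-1), the order of the places being the  *)
(* order of the coordinates.                                                  *)
Definition AG_code n (P : 'I_n -> place) (G : divisor) : {set 'rV[F]_n} :=
  [set v | `[< exists2 z, riemann_roch_space G z &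
                          v = \row_i place_eval (P i) z >] ].

(* The projective line over F; None is the point at infinity.                 *)
Definition P1 := option F.

Definition regular_at (alpha : P1) : {pred ratfun} :=
  match alpha with
  | Some a => [pred z | `[< exists f g : {poly F},
      g.[a] != 0 /\ z = tofrac f / tofrac g >] ]
  | None => [pred z | `[< exists f g : {poly F},
      [/\ g != 0, (size f <= size g)%N &
          z = tofrac f / tofrac g] >] ]
  end.

Lemma regular_at_valuation_ring (alpha : P1) :
  valuation_ring (regular_at alpha).
Proof.
have nz (g : {poly F}) : g != 0 -> tofrac g != 0 :> ratfun.
  by move=> g0; rewrite tofrac_eq0.
have cM (f g h k : {poly F}) : g != 0 -> k != 0 ->
    (tofrac f / tofrac g)
    * (tofrac h / tofrac k)
    = tofrac (f * h) / tofrac (g * k) :> ratfun.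
  by move=> g0 k0; rewrite !tofracM mulf_div.
have cB (f g h k : {poly F}) : g != 0 -> k != 0 ->
    (tofrac f / tofrac g)
    - (tofrac h / tofrac k)
    = tofrac (f * k - h * g) / tofrac (g * k) :> ratfun.
  move=> g0 k0; rewrite -mulNr addf_div ?nz // tofracB !tofracM.
  by rewrite mulNr.
case: alpha => [a|].
- have hz (g : {poly F}) : g.[a] != 0 -> g != 0.
    by apply: contraNneq => ->; rewrite horner0.
  split.
  + split.
    * apply/asboolP; exists 1, 1; rewrite hornerC oner_eq0.
      by rewrite tofrac1 divr1.
    * move=> _ _ /asboolP[f [g [g0 ->]]] /asboolP[h [k [k0 ->]]].
      apply/asboolP; exists (f * k - h * g), (g * k).
      by rewrite hornerM mulf_neq0 // cB ?hz.
    * move=> _ _ /asboolP[f [g [g0 ->]]] /asboolP[h [k [k0 ->]]].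
      apply/asboolP; exists (f * h), (g * k).
      by rewrite hornerM mulf_neq0 // cM ?hz.
  + move=> c; apply/asboolP; exists c%:P, 1.
    by rewrite hornerC oner_eq0 tofrac1 divr1.
  + exists rat_x.
      apply/asboolP; exists 'X, 1.
      by rewrite hornerC oner_eq0 tofrac1 divr1.
    move=> c; rewrite tofrac_eq; apply/eqP => /(congr1 (fun p => size (polyseq p))).
    by rewrite size_polyX size_polyC; case: eqP.
  + exists (tofrac ('X - a%:P))^-1.
    apply/asboolP => -[f [g [g0 e]]].
    have := congr1 (fun z => z * tofrac ('X - a%:P)
                             * tofrac g) e.
    rewrite mulVf ?nz ?polyXsubC_eq0 // mul1r mulrAC divfK ?nz ?hz //.
    rewrite -tofracM => /eqP; rewrite tofrac_eq => /eqP eg.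
    by move: g0; rewrite eg hornerM hornerXsubC subrr mulr0 eqxx.
  + move=> z z0; have [f [g]] := tofrac_ex z; move: {2}(size g) (leqnn (size g)).
    move=> m; elim: m f g => [|m IH] f g.
      by rewrite leqn0 size_poly_eq0 => /eqP-> []; rewrite eqxx.
    move=> sg [g0 ez].
    have [ga|ga] := eqVneq g.[a] 0; last first.
      by left; apply/asboolP; exists f, g.
    have [fa|fa] := eqVneq f.[a] 0; last first.
      by right; apply/asboolP; exists g, f; rewrite ez invf_div.
    have /factor_theorem[g' eg] : root g a by apply/rootP.
    have /factor_theorem[f' ef] : root f a by apply/rootP.
    have X0 : 'X - a%:P != 0 by rewrite polyXsubC_eq0.
    have g'0 : g' != 0 by apply: contraNneq g0 => g'0; rewrite eg g'0 mul0r.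
    apply: (IH f' g'); last first.
      by split=> //; rewrite ez ef eg !tofracM -mulf_div divff ?nz // mulr1.
    by move: sg; rewrite eg size_Mmonic ?monicXsubC // size_XsubC addn2.
- split.
  + split.
    * apply/asboolP; exists 1, 1; rewrite oner_eq0 leqnn.
      by rewrite tofrac1 divr1.
    * move=> _ _ /asboolP[f [g [g0 sf ->]]] /asboolP[h [k [k0 sh ->]]].
      apply/asboolP; exists (f * k - h * g), (g * k).
      split; [by rewrite mulf_neq0 | | by rewrite cB].
      rewrite (leq_trans (size_polyD _ _)) // size_polyN geq_max.
      have le (p p' q : {poly F}) : p' != 0 -> q != 0 ->
          (size p <= size p')%N -> (size (p * q)%R <= size (p' * q)%R)%N.
        move=> p'0 q0 lep; have [->|p0] := eqVneq p 0; first by rewrite mul0r size_poly0.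
        by rewrite !size_mul // -!subn1 leq_sub2r // leq_add2r.
      by rewrite le // mulrC [g * k]mulrC [g * h]mulrC le.
    * move=> _ _ /asboolP[f [g [g0 sf ->]]] /asboolP[h [k [k0 sh ->]]].
      apply/asboolP; exists (f * h), (g * k).
      split; [by rewrite mulf_neq0 | | by rewrite cM].
      rewrite (leq_trans (size_polyMleq _ _)) // size_mul //.
      by rewrite -!subn1 leq_sub2r // leq_add.
  + move=> c; apply/asboolP; exists c%:P, 1.
    by rewrite oner_eq0 tofrac1 divr1 size_poly1 size_polyC leq_b1.
  + exists rat_x^-1.
      apply/asboolP; exists 1, 'X.
      by rewrite polyX_eq0 size_poly1 size_polyX tofrac1 mul1r.
    move=> c; apply/eqP => /(congr1 (fun z => z * rat_x)).
    rewrite mulVf ?nz ?polyX_eq0 // -tofracM -tofrac1 => /eqP.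
    rewrite tofrac_eq => /eqP /(congr1 (fun p : {poly F} => p.[0])).
    by rewrite !hornerE => /eqP; rewrite oner_eq0.
  + exists rat_x; apply/asboolP => -[f [g [g0 sf e]]].
    have := congr1 (fun z => z * tofrac g) e.
    rewrite divfK ?nz // -tofracM => /eqP; rewrite tofrac_eq => /eqP ef.
    by move: sf; rewrite -ef mulrC size_mulX // ltnn.
  + move=> z z0; have [f [g [g0 ez]]] := tofrac_ex z.
    have [le|/ltnW le] := leqP (size f) (size g).
      by left; apply/asboolP; exists f, g.
    right; apply/asboolP; exists g, f; split=> //; last by rewrite ez invf_div.
    by apply: contraNneq z0 => f0; rewrite ez f0 tofrac0 mul0r.
Qed.

Definition P1_place (alpha : P1) : place :=
  Place (regular_at_valuation_ring alpha).

Lemma P1_place_zero (a : F) :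
  rat_x - rat_const a \in place_ideal (P1_place (Some a)).
Proof.
rewrite /rat_x /rat_const -tofracB; apply/andP; split.
  by apply/asboolP; exists ('X - a%:P), 1; rewrite hornerC oner_eq0 tofrac1 divr1.
apply/negP => /and3P[_ _ /asboolP[f [g [g0 e]]]].
have gn : g != 0 by apply: contraNneq g0 => ->; rewrite horner0.
have := congr1 (fun z => z * tofrac ('X - a%:P) * tofrac g) e.
rewrite mulVf ?tofrac_eq0 ?polyXsubC_eq0 // mul1r mulrAC divfK ?tofrac_eq0 //.
rewrite -tofracM => /eqP; rewrite tofrac_eq => /eqP eg.
by move: g0; rewrite eg hornerM hornerXsubC subrr mulr0 eqxx.
Qed.

Lemma P1_place_pole : rat_x^-1 \in place_ideal (P1_place None).
Proof.
apply/andP; split.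
  apply/asboolP; exists 1, 'X.
  by rewrite polyX_eq0 size_poly1 size_polyX tofrac1 mul1r.
apply/negP => /and3P[_ _ /asboolP[f [g []]]]; rewrite invrK => g0 sf e.
have := congr1 (fun z => z * tofrac g) e.
rewrite divfK ?tofrac_eq0 // -tofracM => /eqP; rewrite tofrac_eq => /eqP ef.
by move: sf; rewrite -ef mulrC size_mulX // ltnn.
Qed.

(* The center of GL_2(F) is the group of scalar matrices.                     *)
Definition PGL2 := coset_of 'Z('GL_2[F]).

Definition moebius (M : 'M[F]_2) (alpha : P1) : P1 :=
  let a := M 0 0 in let b := M 0 1 in let c := M 1 0 in let d := M 1 1 in
  match alpha with
  | Some x => if c * x + d == 0 then None
              else Some ((a * x + b) / (c * x + d))
  | None => if c == 0 then None else Some (a / c)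
  end.

(* PGL2_actE below: the choice of the representative matrix is irrelevant.    *)
Definition PGL2_act (A : PGL2) (alpha : P1) : P1 :=
  moebius (GLval (repr A)) alpha.

Lemma center_GL2_scalar (g : {'GL_2[F]}) :
  g \in 'Z('GL_2[F])%g -> exists2 c, c != 0 & GLval g = c%:M.
Proof.
move=> /centerP[_ cg].
pose U i j : 'M[F]_2 := 1%:M + delta_mx i j.
have detU (i j : 'I_2) : i != j -> U i j \in unitmx.
  move=> ij; have/mulmx1_unit[] // : U i j *m (1%:M - delta_mx i j) = 1%:M.
  rewrite mulmxBr mulmx1 mulmxDl mul1mx mul_delta_mx_0; last by rewrite eq_sym.
  by rewrite addr0 addrK.
have comU (i j : 'I_2) : i != j -> GLval g *m U i j = U i j *m GLval g.
  move=> ij.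
  pose u : {'GL_2[F]} := Sub (U i j) (detU i j ij).
  by have /(congr1 (@GLval 2 F)) := cg u (finset.in_setT u); rewrite !GL_MxE.
have comD (i j : 'I_2) (ij : i != j) :
    GLval g *m delta_mx i j = delta_mx i j *m GLval g.
  by have := comU i j ij; rewrite mulmxDr mulmxDl mulmx1 mul1mx => /addrI.
have o01 : (0 : 'I_2) != 1 by [].
have gE : GLval g = (GLval g 0 0)%:M.
  have h0 := congr1 (fun M : 'M_2 => M 0 1) (comD 0 1 o01).
  have h1 := congr1 (fun M : 'M_2 => M 1 1) (comD 0 1 o01).
  have h2 := congr1 (fun M : 'M_2 => M 0 0) (comD 1 0 isT).
  rewrite !mxE !big_ord_recl !big_ord0 !mxE /= in h0 h1 h2.
  rewrite ?(mulr0, mul0r, addr0, add0r, mulr1, mul1r) in h0 h1 h2.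
  have l01 : fintype.lift ord0 ord0 = 1 :> 'I_2 by exact: val_inj.
  rewrite l01 in h0 h2.
  have o2 (i : 'I_2) : i = 0 \/ i = 1.
    by case: i => [[|[|//]] ?]; [left | right]; apply: val_inj.
  apply/matrixP => i j; rewrite !mxE.
  by have [->|->] := o2 i; have [->|->] := o2 j; rewrite ?eqxx ?mulr1n.
exists (GLval g 0 0) => //; apply: contraTneq (GL_unitmx g) => g0.
have -> : val g = 0 :> 'M_2 by apply: etrans gE _; rewrite g0 raddf0.
by rewrite unitmxE det0 unitr0.
Qed.

Lemma moebius_scale (c : F) (M : 'M[F]_2) (alpha : P1) :
  c != 0 -> moebius (c *: M) alpha = moebius M alpha.
Proof.
move=> c0; case: alpha => [x|]; rewrite /moebius !mxE.
  rewrite -!mulrA -!mulrDr mulf_eq0 (negbTE c0) /=.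
  by case: ifP => // _; rewrite -mulf_div divff // mul1r.
rewrite mulf_eq0 (negbTE c0) /=.
by case: ifP => // _; rewrite -mulf_div divff // mul1r.
Qed.

Lemma PGL2_actE (g : {'GL_2[F]}) (alpha : P1) :
  PGL2_act (coset 'Z('GL_2[F])%g g) alpha = moebius (GLval g) alpha.
Proof.
have nZ : g \in 'N('Z('GL_2[F]))%g.
  by have /fintype.subsetP := normal_norm (center_normal 'GL_2[F]); apply; rewrite inE.
rewrite /PGL2_act; have := mem_repr_coset (coset 'Z('GL_2[F])%g g).
rewrite val_coset // => /rcosetP[z /center_GL2_scalar[c c0 zE] ->].
by rewrite GL_MxE zE mul_scalar_mx moebius_scale.
Qed.

(* C(A, alpha, beta, r); the points of the orbit are                          *)
(* alpha_(i+1) = A^-i . alpha for i < n, with n the order of A.               *)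
Definition sigma_cyclic_code (A : PGL2) (alpha beta : P1) (r : nat) :
    {set 'rV[F]_(#[A]%g)} :=
  AG_code (fun i : 'I_(#[A]%g) => P1_place (iter i (PGL2_act A^-1%g) alpha))
          << r%:Z *g P1_place beta >>.

(* Dimension of a linear code (as the AG codes are), seen as a set of words.  *)
Definition code_dim n (C : {set 'rV[F]_n}) : nat := \dim <<enum C>>%VS.

(* Such a matrix is necessarily square; the rectangular type only spares a    *)
(* cast between two lengths known to be equal.                                *)
Definition monomial_mx m n (M : 'M[F]_(m, n)) : Prop :=
  (forall i, #|[set j | M i j != 0]| = 1%N) /\
  (forall j, #|[set i | M i j != 0]| = 1%N).

Definition code_equiv m n (C1 : {set 'rV[F]_m}) (C2 : {set 'rV[F]_n}) : Prop :=
  exists2 M : 'M[F]_(m, n), monomial_mx M & C2 = [set c *m M | c in C1].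

End RationalFunctionField.

(* Main.v *)
Require Import Defs.
From HB Require Import structures.
From mathcomp Require Import boolp classical_sets freeg.
From mathcomp Require Import all_boot all_order all_fingroup all_algebra.
From mathcomp Require Import all_solvable.

Set Implicit Arguments.
Unset Strict Implicit.
Unset Printing Implicit Defensive.

Import Order.TTheory GRing.Theory Num.Theory.
Local Open Scope ring_scope.

(** The reason is that every such code is a Reed-Solomon code, on a point set
that the length determines up to an affine change of variable.

Let [phi] be the coordinate of the projective line with its only pole at
[beta]: [x] if [beta] is infinite, [1 / (x - beta)] otherwise. The space
L(r P_beta) consists of the polynomials of degree at most [r] in [phi]
([riemann_roch_P1]), so the code is obtained by evaluating these polynomials at
the scalars [phi (alpha_i)] ([AG_code_P1]). The divisor condition quantifies
over all abstract places. In one direction this is harmless: the ring of a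
place other than [P_beta] contains [phi], since a place whose maximal ideal contains
[1 / phi] must be [P_beta] ([P1_place_unique]). In the other direction one
tests a function at the place of each irreducible polynomial, which forces its
denominator to be a power of [x - beta], and at infinity, which bounds the
degree.

Seen through [phi], a transformation [A^-1] fixing [beta] fixes infinity, so
it is an affine map [T] of the field, and by faithfulness of the action
[T^k (u) = u] at a moved point [u] holds exactly when the order [n] of [A]
divides [k] ([PGL2_orbit]). Either [T] is a translation and [n] is the
characteristic, or [T] is a homothety about its fixed point whose ratio is a
primitive [n]-th root of unity; the two cannot occur for the same [n]. In the
first case an affine map carries one orbit to the other point by point. In the
second it does so up to a permutation, because any two primitive [n]-th roots
of unity are powers of each other ([affine_orbits]).

An affine change of variable preserves the polynomials of degree at most [r],
so a permutation matrix carries one code to the other as soon as their degree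
bounds agree ([rs_code_equiv]); they do, because the dimension of the code is
[r + 1] when [r < n] ([dim_rs_code]). *)

(** * Places and their valuations *)

Section Places.
Variable F : finFieldType.
Notation ratfun := {fraction {poly F}}.
Implicit Types (P : place F) (z t w : ratfun).

HB.instance Definition _ := GRing.RMorphism.copy (@rat_const F) (@tofrac _ \o polyC).

Lemma place_ring_closed P : subring_closed (place_ring P).
Proof. by case: (place_ringP P). Qed.

HB.instance Definition _ P :=
  GRing.isSubringClosed.Build ratfun (place_ring P) (place_ring_closed P).

Lemma rat_const_place_ring P a : rat_const a \in place_ring P.
Proof. by case: (place_ringP P). Qed.

Lemma place_idealE P z :
  (z \in place_ideal P) = (z \in place_ring P) && ((z == 0) || (z^-1 \notin place_ring P)).
Proof.
rewrite !inE; case: (z \in place_ring P) => //=.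
by rewrite negb_and negbK.
Qed.

Lemma place_ideal_ring P z : z \in place_ideal P -> z \in place_ring P.
Proof. by case/andP. Qed.

Lemma place_idealM P w z :
  w \in place_ring P -> z \in place_ideal P -> w * z \in place_ideal P.
Proof.
move=> wO; rewrite !place_idealE => /andP[zO zI]; rewrite rpredM //=.
have [|wz0 /=] := eqVneq (w * z) 0 => //.
case/orP: zI => [/eqP z0|]; first by rewrite z0 mulr0 eqxx in wz0.
apply: contra => wzO.
suff -> : z^-1 = w * (w * z)^-1 by rewrite rpredM.
have /andP[w0 z0] : (w != 0) && (z != 0) by rewrite -negb_or -mulf_eq0.
by rewrite invfM (mulVKf w0).
Qed.

Lemma one_notin_place_ideal P : 1 \notin place_ideal P.
Proof. by rewrite place_idealE invr1 rpred1 oner_eq0. Qed.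

(** Valuation rings are local: of two nonzero non-units [y] and [z], one of
[y / z] and [z / y] is regular, and factoring out the denominator exhibits
[y + z] as a multiple of a non-unit. *)
Lemma place_ideal_closed P : zmod_closed (place_ideal P).
Proof.
have ideal0 : 0 \in place_ideal P by rewrite place_idealE rpred0 eqxx.
have idealN z : z \in place_ideal P -> - z \in place_ideal P.
  by move=> zI; rewrite -mulN1r place_idealM // rpredN1.
split=> // y z yI /idealN; move: (- z) => {}z zI.
have [->|z0] := eqVneq z 0; first by rewrite addr0.
have [->|y0] := eqVneq y 0; first by rewrite add0r.
have yz0 : y / z != 0 := mulf_neq0 y0 (invr_neq0 z0).
case: (place_ringP P) => _ _ _ _ /(_ _ yz0)[]; rewrite ?invf_div => q.
  have -> : y + z = (y / z + 1) * z by rewrite mulrDl mul1r (divfK z0).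
  by rewrite place_idealM // rpredD // rpred1.
have -> : y + z = (1 + z / y) * y by rewrite mulrDl mul1r (divfK y0).
by rewrite place_idealM // rpredD // rpred1.
Qed.

HB.instance Definition _ P :=
  GRing.isZmodClosed.Build ratfun (place_ideal P) (place_ideal_closed P).

Lemma rat_const_place_ideal P a : (rat_const a \in place_ideal P) = (a == 0).
Proof.
have [->|a0] := eqVneq a 0; first by rewrite rmorph0 rpred0.
rewrite place_idealE -fmorphV rat_const_place_ring /= rat_const_place_ring orbF.
by rewrite fmorph_eq0; apply/negbTE.
Qed.

Lemma place_evalE P z a : z - rat_const a \in place_ideal P -> place_eval P z = a.
Proof.
move=> za; rewrite /place_eval; case: pickP => [b zb|/(_ a)]; last by rewrite za.
apply/eqP; rewrite -subr_eq0 -(rat_const_place_ideal P) rmorphB /=.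
have -> : rat_const b - rat_const a = (z - rat_const a) - (z - rat_const b).
  by rewrite opprB [RHS]addrC addrA subrK.
exact: rpredB.
Qed.

Definition rat_horner (f : {poly F}) z : ratfun := (map_poly (@rat_const F) f).[z].

Lemma rat_horner_ring P f z : z \in place_ring P -> rat_horner f z \in place_ring P.
Proof.
move=> zO; rewrite /rat_horner horner_coef rpred_sum // => i _.
by rewrite coef_map rpredM ?rpredX //= rat_const_place_ring.
Qed.

(** Congruences modulo the place are compatible with polynomial expressions. *)
Lemma rat_horner_sub_ideal P f z a : z - rat_const a \in place_ideal P ->
  rat_horner f z - rat_const f.[a] \in place_ideal P.
Proof.
move=> za; elim/poly_ind: f => [|f c IH].
  by rewrite /rat_horner horner0 !rmorph0 horner0 subrr rpred0.
have zO : z \in place_ring P.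
  rewrite -(subrK (rat_const a) z) rpredD ?rat_const_place_ring //.
  exact: place_ideal_ring.
rewrite /rat_horner rmorphD rmorphM /= map_polyX map_polyC /= !hornerE.
rewrite rmorphD rmorphM /=.
set fz := (X in X * z); set fa := rat_const f.[a].
have -> : fz * z + rat_const c - (fa * rat_const a + rat_const c) =
  z * (fz - fa) + fa * (z - rat_const a).
  by rewrite opprD addrACA subrr addr0 !mulrBr [z * fz]mulrC [z * fa]mulrC addrA subrK.
by rewrite rpredD ?place_idealM // rat_const_place_ring.
Qed.

Lemma place_eval_horner P f z a :
  z - rat_const a \in place_ideal P -> place_eval P (rat_horner f z) = f.[a].
Proof. by move=> za; apply: place_evalE; exact: rat_horner_sub_ideal. Qed.

Lemma place_ext P Q : place_ring P =i place_ring Q -> P = Q.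
Proof.
case: P Q => [O OP] [O' OP'] /= e.
have {}e : O = O' by apply: funext => z; exact: e.
by rewrite e in OP *; congr Place; exact: Prop_irrelevance.
Qed.

(** The maximal ideal is not zero, because a valuation ring is not the whole
field and the inverse of an element outside it is a non-unit. *)
Lemma prime_element_neq0 P t : prime_element P t -> t != 0.
Proof.
move=> tP; case: (place_ringP P) => _ _ _ [z zO] tot.
have z0 : z != 0 by apply: contraNneq zO => ->; rewrite rpred0.
have [zO'|ziO] := tot _ z0; first by case/negP: zO.
have : z^-1 \in place_ideal P by rewrite place_idealE ziO invrK zO orbT.
move=> /tP[w _ e]; apply: contraNneq z0 => t0.
by move/eqP: e; rewrite t0 mul0r invr_eq0.
Qed.

Lemma prime_element_ideal P t : prime_element P t -> t \in place_ideal P.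
Proof. by move=> tP; apply/tP; exists 1; rewrite ?rpred1 ?mulr1. Qed.

Lemma prime_expz_ring P t (m : int) : prime_element P t ->
  (t ^ m \in place_ring P) = (0 <= m).
Proof.
move=> tP; have tI := prime_element_ideal tP; have t0 := prime_element_neq0 tP.
case: m => n; first by rewrite rpredX // place_ideal_ring.
have -> : (0 <= Negz n) = false by [].
apply/negP => tn; have /negP[] := one_notin_place_ideal P.
rewrite -(mulVf (expf_neq0 n.+1 t0)); apply: place_idealM => //.
by rewrite exprSr place_idealM // rpredX // place_ideal_ring.
Qed.

(** Where no prime element exists, the valuation takes its default value 0 and
the bound holds trivially, so the lemma applies to an arbitrary place. *)
Lemma place_val_ge P z (r : nat) :
  (forall t, prime_element P t -> t ^+ r * z \in place_ring P) ->
  - r%:Z <= place_val P z.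
Proof.
move=> zO; rewrite /place_val; case: xgetP => [m _ [t [u [tP /and3P[u0 uO uiO] ze]]]|_].
  2: by rewrite oppr_le0.
have t0 := prime_element_neq0 tP.
rewrite lerNl -subr_ge0 opprK addrC -(prime_expz_ring _ tP) (expfzDr _ _ t0).
have := zO _ tP; rewrite ze mulrA [_ * t ^ m]mulrC => q.
rewrite -[X in X \in _](mulfK u0).
exact: rpredM.
Qed.

(** The elements at which [place_val] is a genuine valuation and not the default
value. *)
Definition has_valuation P z :=
  exists m t u, [/\ prime_element P t, u \in place_unit P & z = t ^ m * u].

(** A converse of [place_val_ge]. The factorization of [z] rules out the default
value of [place_val], which would carry no information. *)
Lemma place_val_ge_ring P t z (r : nat) : t \in place_ideal P ->
  has_valuation P z -> - r%:Z <= place_val P z -> t ^+ r * z \in place_ring P.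
Proof.
move=> tI [m [t' [u h]]]; rewrite /place_val; case: xgetP => [{h}m' _ |/(_ m)]; last first.
  by case; exists t', u.
case=> {}t' [{}u [tP /and3P[u0 uO uiO] ->]] mr.
have [w wO ->] := (tP t).1 tI.
have t'0 := prime_element_neq0 tP.
have -> : (t' * w) ^+ r * (t' ^ m' * u) = t' ^ (r%:Z + m') * (w ^+ r * u).
  rewrite (expfzDr _ _ t'0) exprMn -exprnP !mulrA; congr (_ * u).
  by rewrite mulrAC.
apply: rpredM; last by apply: rpredM => //; exact: rpredX.
by rewrite (prime_expz_ring _ tP) addrC -lerBlDr sub0r.
Qed.

End Places.

(** * Places of irreducible polynomials *)

Section IrreduciblePlaces.
Variable F : finFieldType.
Notation ratfun := {fraction {poly F}}.
Implicit Types (f g h : {poly F}) (z t w : ratfun).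

Lemma tofrac_neq0 g : g != 0 -> tofrac g != 0 :> ratfun.
Proof. by rewrite tofrac_eq0. Qed.

Lemma fracE f g h k : g != 0 -> k != 0 ->
  tofrac f / tofrac g = tofrac h / tofrac k :> ratfun -> f * k = h * g.
Proof.
move=> /tofrac_neq0 g0 /tofrac_neq0 k0 /eqP; rewrite (eqr_div _ _ g0 k0).
by rewrite -!tofracM tofrac_eq => /eqP.
Qed.

(** The local ring of the affine line at the closed point defined by [h]. *)
Definition irr_regular h : {pred ratfun} :=
  [pred z | `[< exists f g, ~~ (h %| g) /\ z = tofrac f / tofrac g >] ].

Lemma ndvdp_neq0 h g : ~~ (h %| g) -> g != 0.
Proof. by apply: contraNneq => ->; exact: dvdp0. Qed.

Lemma irreducible_dvdpM h f g : irreducible_poly h ->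
  (h %| f * g) = (h %| f) || (h %| g).
Proof.
move=> hI; apply/idP/orP => [|[hf|hg]]; [|exact: dvdp_mulr|exact: dvdp_mull].
have [hf|hf] := boolP (h %| f); first by left.
by rewrite Gauss_dvdpr ?irreducible_poly_coprime //; right.
Qed.

(** A divisor of minimal positive degree is irreducible; the induction on the
degree finds one. *)
Lemma exists_irreducible_dvdp g : (1 < size g)%N ->
  exists2 h, irreducible_poly h & h %| g.
Proof.
elim: (size g).+1 {-2}g (ltnSn (size g)) => // n IH {}g gn g1.
have [gI|gI] := pselect (irreducible_poly g); first by exists g.
have [d [d1 dg dng]] : exists d : {poly F}, [/\ size d != 1%N, d %| g & ~~ (d %= g)].
  apply: contrapT => nd; apply: gI; split=> // d d1 dg.
  by apply: contrapT => /negP dng; apply: nd; exists d.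
have g0 : g != 0 by rewrite -size_poly_gt0 (ltn_trans _ g1).
have ltdg : (size d < size g)%N.
  by rewrite ltn_neqAle dvdp_leq // andbT dvdp_size_eqp.
have [|h hI hd] := IH d (leq_trans ltdg gn); last by exists h; rewrite ?(dvdp_trans hd).
rewrite ltn_neqAle eq_sym d1 size_poly_gt0.
by apply: contraNneq g0 => d0; rewrite d0 dvd0p in dg.
Qed.

Lemma dvdp_multiplicity h f : (1 < size h)%N -> f != 0 ->
  exists k f', ~~ (h %| f') /\ f = f' * h ^+ k.
Proof.
move=> h1; elim: (size f).+1 {-2}f (ltnSn (size f)) => // n IH {}f fn f0.
have [/dvdpP[f' fE]|hf] := boolP (h %| f); last by exists 0%N, f; rewrite mulr1.
have [f'0 h0] : f' != 0 /\ h != 0.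
  by apply/andP; rewrite -negb_or -mulf_eq0 -fE.
have [||k [f'' [nd f'E]]] := IH f' => //.
  rewrite -ltnS (leq_trans _ fn) // ltnS fE size_mul //.
  by case: (size h) h1 => [|[|m _]] //; rewrite !addnS ltnS leq_addr.
by exists k.+1, f''; split=> //; rewrite fE f'E exprSr mulrA.
Qed.

Section Irreducible.
Variable h : {poly F}.
Hypothesis hI : irreducible_poly h.

(** Totality is the only axiom with content: removing the powers of [h] from the
numerator and the denominator of a fraction leaves a power of [h] on one side
only. *)
Lemma irr_regular_ring : valuation_ring (irr_regular h).
Proof.
have h1 : (1 < size h)%N by case: hI.
have nd1 : ~~ (h %| 1) by rewrite dvdp1 neq_ltn h1 orbT.
have ndM f g : ~~ (h %| f) -> ~~ (h %| g) -> ~~ (h %| f * g).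
  by move=> hf hg; rewrite irreducible_dvdpM // negb_or hf.
have inPoly f : tofrac f \in irr_regular h.
  by apply/asboolP; exists f, 1; rewrite tofrac1 divr1.
split; [split | | | |].
- by rewrite -tofrac1 inPoly.
- move=> _ _ /asboolP[f [g [g0 ->]]] /asboolP[f' [g' [g'0 ->]]].
  apply/asboolP; exists (f * g' - f' * g), (g * g'); split; first exact: ndM.
  have := tofrac_neq0 (ndvdp_neq0 g0); have := tofrac_neq0 (ndvdp_neq0 g'0).
  move=> n0 n0'; rewrite -mulNr (addf_div _ _ n0' n0) tofracB !tofracM.
  by rewrite mulNr.
- move=> _ _ /asboolP[f [g [g0 ->]]] /asboolP[f' [g' [g'0 ->]]].
  apply/asboolP; exists (f * f'), (g * g'); split; first exact: ndM.
  by rewrite mulf_div !tofracM.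
- by move=> a; exact: inPoly.
- exists (rat_x F) => [|a]; first exact: inPoly.
  rewrite tofrac_eq; apply/eqP => /(congr1 (fun p => size (polyseq p))).
  by rewrite size_polyX size_polyC; case: eqP.
- exists (tofrac h)^-1; apply/asboolP => -[f [g [g0 e]]].
  have := @fracE 1 h f g (irredp_neq0 hI) (ndvdp_neq0 g0).
  rewrite tofrac1 mul1r => /(_ e); rewrite mul1r => gE.
  by rewrite gE dvdp_mull in g0.
- move=> z z0; have [f [g [g0 zE]]] := tofrac_ex z.
  have f0 : f != 0 by apply: contraNneq z0 => f0; rewrite zE f0 tofrac0 mul0r.
  have [k [f' [hf' fE]]] := dvdp_multiplicity h1 f0.
  have [l [g' [hg' gE]]] := dvdp_multiplicity h1 g0.
  have th0 : tofrac h != 0 :> ratfun := tofrac_neq0 (irredp_neq0 hI).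
  have [lk|/ltnW kl] := leqP l k; [left|right]; apply/asboolP.
    exists (f' * h ^+ (k - l)), g'; split=> //.
    rewrite zE fE gE -(subnK lk) exprD mulrA addnK !tofracM !tofracXn.
    by rewrite -mulf_div (divff (expf_neq0 l th0)) mulr1.
  exists (g' * h ^+ (l - k)), f'; split=> //.
  rewrite zE fE gE -(subnK kl) exprD mulrA addnK !tofracM !tofracXn.
  by rewrite -mulf_div (divff (expf_neq0 k th0)) mulr1 invf_div.
Qed.

Definition irr_place : place F := Place irr_regular_ring.

Lemma irr_place_unit f : ~~ (h %| f) -> tofrac f \in place_unit irr_place.
Proof.
move=> hf; apply/and3P; split; first exact: tofrac_neq0 (ndvdp_neq0 hf).
  apply/asboolP; exists f, 1; rewrite tofrac1 divr1 dvdp1 neq_ltn.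
  by rewrite hI.1 orbT.
by apply/asboolP; exists 1, f; rewrite tofrac1 mul1r.
Qed.

Lemma tofrac_irr_place f : tofrac f \in place_ring irr_place.
Proof.
apply/asboolP; exists f, 1; rewrite tofrac1 divr1 dvdp1 neq_ltn.
by rewrite hI.1 orbT.
Qed.

Lemma irr_place_prime : prime_element irr_place (tofrac h).
Proof.
have h0 := irredp_neq0 hI.
move=> z; split=> [|[w wO ->]].
  rewrite place_idealE => /andP[/asboolP[f [g [hg zE]]] zI].
  suff /dvdpP[f' fE] : h %| f.
    exists (tofrac f' / tofrac g); first by apply/asboolP; exists f', g.
    by rewrite zE fE tofracM mulrA [_ h * _]mulrC.
  apply: contraLR zI => hf; rewrite negb_or negbK; apply/andP; split.
    have f0 := tofrac_neq0 (ndvdp_neq0 hf).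
    by rewrite zE; apply: mulf_neq0 f0 (invr_neq0 (tofrac_neq0 (ndvdp_neq0 hg))).
  by apply/asboolP; exists g, f; rewrite zE invf_div.
rewrite mulrC place_idealM // place_idealE tofrac_irr_place /=.
apply/orP; right; apply/asboolP => -[f [g [g0 e]]].
have := @fracE 1 h f g h0 (ndvdp_neq0 g0).
rewrite tofrac1 mul1r => /(_ e); rewrite mul1r => gE.
by rewrite gE dvdp_mull in g0.
Qed.

End Irreducible.
End IrreduciblePlaces.

(** * Prime elements and valuations at rational places *)

Section RationalPlaces.
Variable F : finFieldType.
Notation ratfun := {fraction {poly F}}.
Implicit Types (f g h : {poly F}) (z t w : ratfun) (P : place F).

Lemma expfz_subn (K : fieldType) (t : K) (k l : nat) : t != 0 ->
  t ^ (k%:Z - l%:Z) = t ^+ k / t ^+ l.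
Proof. by move=> t0; rewrite expfzDr // exprnN. Qed.

Lemma irr_place_valuation h (hI : irreducible_poly h) z :
  z != 0 -> has_valuation (irr_place hI) z.
Proof.
move=> z0; have [f [g [g0 zE]]] := tofrac_ex z.
have f0 : f != 0 by apply: contraNneq z0 => f0; rewrite zE f0 tofrac0 mul0r.
have [k [f' [hf' fE]]] := dvdp_multiplicity hI.1 f0.
have [l [g' [hg' gE]]] := dvdp_multiplicity hI.1 g0.
have /and3P[tf0 tf tfi] := irr_place_unit hI hf'.
have /and3P[tg0 tg tgi] := irr_place_unit hI hg'.
exists (k%:Z - l%:Z), (tofrac h), (tofrac f' / tofrac g'); split.
- exact: irr_place_prime.
- apply/and3P; split; last by rewrite invf_div; exact: rpredM.
    exact: mulf_neq0 tf0 (invr_neq0 tg0).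
  exact: rpredM.
rewrite (expfz_subn _ _ (tofrac_neq0 (irredp_neq0 hI))) zE fE gE.
by rewrite !tofracM !tofracXn -mulf_div mulrC.
Qed.

Lemma P1_place_Some (a : F) : P1_place (Some a) = irr_place (irredp_XsubC a).
Proof.
apply: place_ext => z; apply/asboolP/asboolP => -[f [g [ga ->]]]; exists f, g.
  by rewrite dvdp_XsubCl.
by rewrite dvdp_XsubCl in ga.
Qed.

(** A fraction in the ring at infinity whose numerator and denominator have equal
degree is invertible there, so a non-unit has a numerator of smaller degree and
is still regular after multiplication by [x]. *)
Lemma P1_place_None_prime : prime_element (P1_place None) (rat_x F)^-1.
Proof.
move=> z; split=> [|[w wO ->]]; last first.
  by rewrite mulrC place_idealM // P1_place_pole.
have x0 : rat_x F != 0 := tofrac_neq0 (negbT (polyX_eq0 F)).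
rewrite place_idealE => /andP[/asboolP[f [g [g0 fg zE]]] zI].
exists (rat_x F * z); last by rewrite (mulKf x0).
apply/asboolP; exists ('X * f), g; split=> //; last by rewrite zE tofracM mulrA.
have [->|f0] := eqVneq f 0; first by rewrite mulr0 size_poly0.
rewrite mulrC size_mulX // ltn_neqAle fg andbT.
apply: contraL zI => /eqP sfg; rewrite negb_or negbK; apply/andP; split.
  by rewrite zE; apply: mulf_neq0 (tofrac_neq0 f0) (invr_neq0 (tofrac_neq0 g0)).
by apply/asboolP; exists g, f; rewrite sfg zE invf_div.
Qed.

(** At infinity the valuation is the degree of the denominator minus the degree
of the numerator; the unit is the fraction with both degrees made equal. *)
Lemma P1_place_None_valuation z : z != 0 -> has_valuation (P1_place None) z.
Proof.
move=> z0; have [f [g [g0 zE]]] := tofrac_ex z.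
have f0 : f != 0 by apply: contraNneq z0 => f0; rewrite zE f0 tofrac0 mul0r.
have Xn0 n : 'X^n != 0 :> {poly F} by rewrite -size_poly_gt0 size_polyXn.
have x0 : rat_x F != 0 := tofrac_neq0 (negbT (polyX_eq0 F)).
pose f' := f * 'X^(size g); pose g' := g * 'X^(size f).
have f'0 : f' != 0 := mulf_neq0 f0 (Xn0 _).
have g'0 : g' != 0 := mulf_neq0 g0 (Xn0 _).
have sfg : size f' = size g' by rewrite !size_mulXn // addnC.
exists ((size g)%:Z - (size f)%:Z), (rat_x F)^-1, (tofrac f' / tofrac g'); split.
- exact: P1_place_None_prime.
- apply/and3P; split.
  + exact: mulf_neq0 (tofrac_neq0 f'0) (invr_neq0 (tofrac_neq0 g'0)).
  + by apply/asboolP; exists f', g'; rewrite sfg.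
  + by apply/asboolP; exists g', f'; rewrite invf_div sfg.
rewrite (expfz_subn _ _ (invr_neq0 x0)) !exprVn invrK !tofracM !tofracXn.
rewrite -mulf_div -/(rat_x F) zE mulrCA [_ * rat_x F ^+ _]mulrC -[_ / _ ^+ _]invf_div.
by rewrite (mulVf (mulf_neq0 (expf_neq0 _ x0) (invr_neq0 (expf_neq0 _ x0)))) mulr1.
Qed.

Lemma P1_place_valuation (alpha : P1 F) z :
  z != 0 -> has_valuation (P1_place alpha) z.
Proof.
case: alpha => [a|]; last exact: P1_place_None_valuation.
rewrite P1_place_Some; exact: irr_place_valuation.
Qed.

(** Every irreducible factor of the denominator cancels: as the fraction is
regular at the place of that factor, the factor divides the numerator too. *)
Lemma irr_place_polynomial z :
  (forall h (hI : irreducible_poly h), z \in place_ring (irr_place hI)) ->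
  exists f, z = tofrac f.
Proof.
move=> zO; have [f [g [g0 zE]]] := tofrac_ex z.
elim: (size g).+1 {-2}g (ltnSn (size g)) f g0 zE => // n IH {}g gn f g0 zE.
have [g1|] := leqP (size g) 1.
  have gE := size1_polyC g1; rewrite gE polyC_eq0 in g0.
  exists (f * (g`_0)^-1%:P); rewrite zE tofracM {1}gE; congr (_ * _).
  by rewrite -/(rat_const _) -/(rat_const _) fmorphV.
move=> /exists_irreducible_dvdp[h hI /dvdpP[g' gE]].
have /asboolP[f1 [g1 [hg1 zE1]]] := zO h hI.
have e : f * g1 = f1 * g.
  by apply: fracE g0 (ndvdp_neq0 hg1) _; rewrite -zE.
have : h %| f * g1 by rewrite e gE mulrA dvdp_mull.
rewrite irreducible_dvdpM // (negPf hg1) orbF => /dvdpP[f' fE].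
have h0 := irredp_neq0 hI.
have g'0 : g' != 0 by apply: contraNneq g0 => g'0; rewrite gE g'0 mul0r.
apply: (IH g' _ f') => //.
  rewrite -ltnS (leq_trans _ gn) // ltnS gE size_mul //.
  by case: (size h) hI.1 => [|[|m _]] //; rewrite !addnS ltnS leq_addr.
by rewrite zE fE gE !tofracM -mulf_div (divff (tofrac_neq0 h0)) mulr1.
Qed.

End RationalPlaces.

(** * The Riemann-Roch space of a multiple of a rational place *)

Section RevPoly.

(** The reciprocal polynomial of [f], relative to the degree bound [n]. *)
Definition rev_poly (R : nzRingType) n (f : {poly R}) : {poly R} :=
  \poly_(i < n.+1) f`_(n - i).

Lemma map_rev_poly (R S : nzRingType) (phi : {rmorphism R -> S}) n (f : {poly R}) :
  map_poly phi (rev_poly n f) = rev_poly n (map_poly phi f).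
Proof.
apply/polyP => i; rewrite coef_map /= [X in phi X]coef_poly [RHS]coef_poly coef_map.
by case: ifP; rewrite ?rmorph0.
Qed.

Lemma horner_rev_poly (K : fieldType) n (f : {poly K}) z :
  z != 0 -> (size f <= n.+1)%N -> f.[z] / z ^+ n = (rev_poly n f).[z^-1].
Proof.
move=> z0 sf; rewrite (horner_coef_wide _ sf) horner_poly.
rewrite mulr_suml [RHS](reindex_inj rev_ord_inj) /=; apply: eq_bigr => i _.
have lei : (i <= n)%N by rewrite -ltnS.
rewrite subSS subKn // -mulrA; congr (_ * _).
by rewrite -{2}(subnK lei) exprD invfM mulrCA divff ?mulr1 ?exprVn ?expf_neq0.
Qed.

End RevPoly.

Section RiemannRoch.
Variable F : finFieldType.
Notation ratfun := {fraction {poly F}}.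
Implicit Types (f g h : {poly F}) (z t w : ratfun) (P : place F) (beta : P1 F).

(** The coordinate [phi]: a generator of the function field whose only pole is a
simple one at [beta]. *)
Definition pole_coord beta : ratfun :=
  if beta is Some b then (rat_x F - rat_const b)^-1 else rat_x F.

Lemma rat_horner_rev n f z : z != 0 -> (size f <= n.+1)%N ->
  rat_horner f z / z ^+ n = rat_horner (rev_poly n f) z^-1.
Proof.
move=> z0 sf; rewrite /rat_horner map_rev_poly horner_rev_poly //.
by rewrite size_map_poly.
Qed.

Lemma rat_horner_comp f g z :
  rat_horner f (rat_horner g z) = rat_horner (f \Po g) z.
Proof. by rewrite /rat_horner map_comp_poly horner_comp. Qed.

Lemma rat_horner_x f : rat_horner f (rat_x F) = tofrac f.
Proof.
rewrite /rat_horner map_poly_comp horner_map /=; congr tofrac.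
by rewrite -/(f \Po 'X) comp_polyXr.
Qed.

Lemma rat_horner_shift f b :
  tofrac f = rat_horner (f \Po ('X + b%:P)) (rat_x F - rat_const b).
Proof.
rewrite -rat_horner_comp -rat_horner_x; congr (rat_horner f _).
by rewrite /rat_horner rmorphD /= map_polyX map_polyC !hornerE subrK.
Qed.

Lemma size_comp_shift f b : size (f \Po ('X + b%:P)) = size f.
Proof. by rewrite size_comp_poly2 // size_XaddC. Qed.

Lemma rat_x_subC (b : F) : rat_x F - rat_const b = tofrac ('X - b%:P).
Proof. by rewrite tofracB. Qed.

Lemma pole_coord_neq0 beta : pole_coord beta != 0.
Proof.
case: beta => [b|] /=; last exact: tofrac_neq0 (negbT (polyX_eq0 F)).
by rewrite rat_x_subC invr_eq0; apply: tofrac_neq0; rewrite polyXsubC_eq0.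
Qed.

Lemma pole_coord_prime beta : prime_element (P1_place beta) (pole_coord beta)^-1.
Proof.
case: beta => [b|]; last exact: P1_place_None_prime.
by rewrite P1_place_Some invrK rat_x_subC; exact: irr_place_prime.
Qed.

(** The local ring at [beta] is the localization at the origin of the
polynomials in the uniformizer [1 / phi]. *)
Lemma P1_place_coord beta z : z \in place_ring (P1_place beta) ->
  exists f g, g.[0] != 0 /\
    z = rat_horner f (pole_coord beta)^-1 / rat_horner g (pole_coord beta)^-1.
Proof.
case: beta => [b|] /asboolP[f [g]].
  move=> [gb ->]; exists (f \Po ('X + b%:P)), (g \Po ('X + b%:P)).
  by rewrite horner_comp !hornerE invrK -!rat_horner_shift.
move=> [g0 fg ->]; have x0 := pole_coord_neq0 None.
exists (rev_poly (size g).-1 f), (rev_poly (size g).-1 g).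
have sg : (size g).-1.+1 = size g by rewrite prednK ?size_poly_gt0.
split; first by rewrite horner_coef0 coef_poly subn0 lead_coef_eq0.
rewrite -!(rat_horner_rev x0) ?sg // !rat_horner_x.
by rewrite -mulf_div (divff (invr_neq0 (expf_neq0 _ x0))) mulr1.
Qed.

(** A polynomial in [1 / phi] with a nonzero constant term is congruent to that
constant modulo [P], hence invertible in the ring of [P], so this ring contains
the ring at [beta]. It is not larger: the inverse of an element outside the
ring at [beta] is a multiple of [1 / phi], so it lies in the ideal of [P]. *)
Lemma P1_place_unique P beta :
  (pole_coord beta)^-1 \in place_ideal P -> P = P1_place beta.
Proof.
move=> tI; have tO := place_ideal_ring tI.
have sub z : z \in place_ring (P1_place beta) -> z \in place_ring P.
  move=> /P1_place_coord[f [g [g0 ->]]].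
  apply: rpredM; first exact: rat_horner_ring.
  have gO := rat_horner_ring g tO.
  apply: contraR g0 => giO; rewrite -(rat_const_place_ideal P).
  set gt := rat_horner g _ in gO giO.
  have gI : gt \in place_ideal P by rewrite place_idealE gO giO orbT.
  rewrite -[rat_const _](subKr gt) rpredB //.
  by apply: rat_horner_sub_ideal; rewrite rmorph0 subr0.
apply: place_ext => z; apply/idP/idP => [zO|/sub //].
apply: contraT => zN.
have z0 : z != 0 by apply: contraNneq zN => ->; rewrite rpred0.
have ziI : z^-1 \in place_ideal (P1_place beta).
  case: (place_ringP (P1_place beta)) => _ _ _ _ /(_ _ z0)[zO'|ziO].
    by case/negP: zN.
  by rewrite place_idealE ziO invrK zN orbT.
have [w /sub wO ze] := (pole_coord_prime _ _).1 ziI.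
case/negP: (one_notin_place_ideal P); rewrite -(mulfV z0) ze.
by rewrite [_^-1 * w]mulrC mulrA place_idealM // rpredM.
Qed.

Lemma pole_coord_ring P beta : P != P1_place beta -> pole_coord beta \in place_ring P.
Proof.
apply: contraR => xN; apply/eqP; apply: P1_place_unique.
case: (place_ringP P) => _ _ _ _ /(_ _ (pole_coord_neq0 beta))[xO|xiO].
  by case/negP: xN.
by rewrite place_idealE xiO invrK xN orbT.
Qed.

Lemma rat_x_notin_P1_place_None : rat_x F \notin place_ring (P1_place None).
Proof.
apply: contra (one_notin_place_ideal (@P1_place F None)) => xO.
by rewrite -(mulfV (pole_coord_neq0 None)) place_idealM // P1_place_pole.
Qed.

Lemma rat_x_P1_place_Some (b : F) : rat_x F \in place_ring (P1_place (Some b)).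
Proof. by rewrite P1_place_Some tofrac_irr_place. Qed.

Lemma size_P1_place_None f n :
  tofrac f / rat_x F ^+ n \in place_ring (P1_place None) -> (size f <= n.+1)%N.
Proof.
move=> /asboolP[f1 [g1 [g10 fg1]]].
have Xn0 : 'X^n != 0 :> {poly F} by rewrite -size_poly_gt0 size_polyXn.
rewrite -tofracXn => /(fracE Xn0 g10) e.
have [->|f0] := eqVneq f 0; first by rewrite size_poly0.
have f10 : f1 != 0.
  by apply: contraNneq (mulf_neq0 f0 g10) => f10; rewrite e f10 mul0r.
have := congr1 (fun p : {poly F} => size p) e.
rewrite size_mul // size_mulXn //; case: (size g1) fg1 => [|m le1].
  by rewrite leqn0 size_poly_eq0 (negPf f10).
rewrite addnS /= => se; rewrite -(leq_add2r m) se addSnnS leq_add2l //.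
Qed.

(** Regularity away from [beta] makes the function a polynomial in [x], after
multiplication by [(x - b) ^ r] when [beta] is a finite point [b]; the degree
is bounded by the condition at infinity, which is the pole condition if [beta]
is infinite and plain regularity otherwise. *)
Lemma riemann_roch_P1 beta (r : nat) z :
  riemann_roch_space << r%:Z *g P1_place beta >> z <->
  exists2 f : {poly F}, (size f <= r.+1)%N & z = rat_horner f (pole_coord beta).
Proof.
have x0 := pole_coord_neq0 beta.
have coeffP P : - coeff P << r%:Z *g P1_place beta >> =
    - (if P == P1_place beta then r else 0)%:Z.
  by rewrite coeffU eq_sym; case: eqP; rewrite ?mulr1 ?mulr0.
split=> [|[f sf ->]]; last first.
  have [|z0] := eqVneq (rat_horner f (pole_coord beta)) 0; [by left|right].
  split=> // P; rewrite coeffP; apply: place_val_ge => t tP.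
  case: eqP => [PE|/eqP PN]; last first.
    by rewrite expr0 mul1r; apply: rat_horner_ring; exact: pole_coord_ring.
  have pi := pole_coord_prime beta; rewrite -PE in pi.
  (* Any prime element [t] at [beta] is a multiple of [1 / phi], and
     [f (phi) / phi ^ r] is a polynomial in [1 / phi]. *)
  have [w wO ->] := (pi _).1 (prime_element_ideal tP).
  rewrite exprMn exprVn mulrAC [_^-1 * _]mulrC (rat_horner_rev x0 sf).
  apply: rpredM; last exact: rpredX.
  by apply: rat_horner_ring; apply: place_ideal_ring; exact: prime_element_ideal.
case=> [->|[z0 zV]].
  by exists 0; rewrite ?size_poly0 // /rat_horner rmorph0 horner0.
(* With the exponent 0 any non-unit can serve as [t], in particular [t = 0]. *)
have zO P : P != P1_place beta -> has_valuation P z -> z \in place_ring P.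
  move=> PN Pz; rewrite -[z]mul1r -(expr0 0).
  apply: (place_val_ge_ring _ Pz); first exact: rpred0.
  by have := zV P; rewrite coeffP (negPf PN).
have zB t : t \in place_ideal (P1_place beta) ->
    t ^+ r * z \in place_ring (P1_place beta).
  move=> tI; apply: place_val_ge_ring => //; first exact: P1_place_valuation.
  by have := zV (P1_place beta); rewrite coeffP eqxx.
case: beta x0 {coeffP zV} zO zB => [b|] x0 zO zB; last first.
  have [h hI|f zE] := @irr_place_polynomial _ z.
    apply: zO; last exact: irr_place_valuation z0.
    apply/eqP => PE; have := rat_x_notin_P1_place_None.
    by rewrite -PE tofrac_irr_place.
  exists f; last by rewrite zE rat_horner_x.
  apply: size_P1_place_None; rewrite -zE mulrC -exprVn; apply: zB.
  exact: P1_place_pole.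
set y := rat_x F - rat_const b; have y0 : y != 0 by rewrite -invr_eq0.
have [h hI|f zE] := @irr_place_polynomial _ (y ^+ r * z).
  have [PE|PN] := eqVneq (irr_place hI) (P1_place (Some b)).
    by rewrite PE; apply: zB; exact: P1_place_zero.
  apply: rpredM; last by apply: (zO _ PN); exact: irr_place_valuation z0.
  by apply: rpredX; rewrite /y rat_x_subC; exact: tofrac_irr_place.
have zE' : z = tofrac f / y ^+ r by rewrite -zE mulrC (mulKf (expf_neq0 r y0)).
(* The degree of [f] is bounded by comparing [(x - b) ^ r] with [x ^ r] at
   infinity, where their quotient is regular. *)
have sf : (size f <= r.+1)%N.
  apply: size_P1_place_None; rewrite -zE mulrAC -exprVn -exprMn.
  apply: rpredM; last first.
    apply: zO; last exact: P1_place_valuation z0.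
    apply/eqP => PE; have := rat_x_notin_P1_place_None.
    by rewrite PE rat_x_P1_place_Some.
  apply: rpredX; rewrite mulrBl (divff (pole_coord_neq0 None)).
  apply: rpredB; first exact: rpred1.
  apply: rpredM; first exact: rat_const_place_ring.
  exact: place_ideal_ring (P1_place_pole F).
exists (rev_poly r (f \Po ('X + b%:P))); first exact: size_poly.
by rewrite -(rat_horner_rev y0) ?size_comp_shift // zE' (rat_horner_shift f b).
Qed.

End RiemannRoch.

(** * Reed-Solomon codes and codes on the projective line *)

Section ReedSolomon.
Variable F : finFieldType.

Definition rs_mx n (u : 'I_n -> F) r : 'M[F]_(r.+1, n) :=
  \matrix_(k, i) u i ^+ k.

Definition rs_code n (u : 'I_n -> F) r : {set 'rV[F]_n} :=
  [set c *m rs_mx u r | c : 'rV_r.+1].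

Lemma mul_rs_mx n (u : 'I_n -> F) r (c : 'rV_r.+1) :
  c *m rs_mx u r = \row_i (rVpoly c).[u i].
Proof.
apply/rowP => i; rewrite !mxE (horner_coef_wide _ (size_poly _ _)).
by apply: eq_bigr => k _; rewrite !mxE coef_rVpoly_ord.
Qed.

Lemma rs_codeP n (u : 'I_n -> F) r v :
  reflect (exists2 f : {poly F}, (size f <= r.+1)%N & v = \row_i f.[u i])
          (v \in rs_code u r).
Proof.
apply: (iffP imsetP) => [[c _ ->]|[f sf ->]].
  by exists (rVpoly c); rewrite ?mul_rs_mx // size_poly.
by exists (poly_rV f); rewrite ?mul_rs_mx ?poly_rV_K.
Qed.

(** A polynomial of degree at most [r] vanishing at [n > r] points is zero, so
encoding is an injective linear map. *)
Lemma dim_rs_code n (u : 'I_n -> F) r :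
  injective u -> (r < n)%N -> code_dim (rs_code u r) = r.+1.
Proof.
move=> uI rn; pose L : 'Hom('rV[F]_r.+1, 'rV[F]_n) := linfun (mulmxr (rs_mx u r)).
have -> : code_dim (rs_code u r) = \dim (limg L).
  rewrite /code_dim; congr (\dim _); apply/eqP; rewrite eqEsubv; apply/andP; split.
    apply/span_subvP => v; rewrite mem_enum => /imsetP[c _ ->].
    by apply/memv_imgP; exists c; rewrite ?memvf // lfunE.
  apply/subvP => v /memv_imgP[c _ ->]; apply: memv_span; rewrite mem_enum.
  by apply/imsetP; exists c; rewrite // lfunE.
rewrite limg_dim_eq ?dimvf /dim /= ?mul1n // capfv.
apply/eqP; rewrite -subv0; apply/subvP => c; rewrite memv_ker lfunE /= mul_rs_mx memv0.
move=> /eqP/rowP c0; rewrite -[c]rVpolyK.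
suff -> : rVpoly c = 0 by rewrite linear0.
apply: (@roots_geq_poly_eq0 _ _ (map u (enum 'I_n))).
- by apply/allP => _ /mapP[i _ ->]; have := c0 i; rewrite !mxE => /rootP.
- by rewrite map_inj_uniq ?enum_uniq.
- by rewrite size_map size_enum_ord (leq_trans (size_poly _ _)).
Qed.

Lemma size_comp_affine (f : {poly F}) c d :
  (size (f \Po (c *: 'X + d%:P)%R) <= size f)%N.
Proof.
have sq : (size (c *: 'X + d%:P)%R <= 2)%N.
  rewrite (leq_trans (size_polyD _ _)) // geq_max (leq_trans (size_scale_leq _ _)) ?size_polyX //.
  by rewrite (leq_trans (size_polyC_leq1 _)).
have [->|f0] := eqVneq f 0; first by rewrite comp_poly0.
rewrite (leq_trans (size_comp_poly_leq _ _)) //.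
case: (size f) (size_poly_gt0 f) => [|k _]; first by rewrite f0.
by rewrite ltnS /= -[leqRHS]muln1 leq_mul // -ltnS; case: (size _) sq => [|[]].
Qed.

(** Substituting the affine map, or its inverse, in the polynomials translates
words of one code into words of the other, and the permutation matrix of [s]
reorders the coordinates. *)
Lemma rs_code_equiv m n (s : 'I_m -> 'I_n) (u : 'I_m -> F) (u' : 'I_n -> F) r c d :
  bijective s -> c != 0 -> (forall i, u' (s i) = c * u i + d) ->
  code_equiv (rs_code u r) (rs_code u' r).
Proof.
move=> [t st ts] c0 us; pose M : 'M[F]_(m, n) := \matrix_(i, j) (s i == j)%:R.
have M0 i j : (M i j != 0) = (s i == j).
  by rewrite mxE; case: (s i == j); rewrite ?oner_eq0 ?eqxx.
have mulM (f g : {poly F}) : (forall i, f.[u i] = g.[u' (s i)]) ->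
    (\row_i f.[u i]) *m M = \row_j g.[u' j].
  move=> fg; apply/rowP => j; rewrite !mxE (bigD1 (t j)) //= big1 => [|i ij].
    by rewrite !mxE fg ts eqxx mulr1 addr0.
  by rewrite !mxE -(inj_eq (can_inj ts)) st (negPf ij) mulr0.
exists M.
  split=> [i|j].
    by rewrite -(cards1 (s i)); congr #|pred_of_set _|; apply/setP => j; rewrite !inE M0 eq_sym.
  rewrite -(cards1 (t j)); congr #|pred_of_set _|; apply/setP => i; rewrite !inE M0.
  by rewrite -(inj_eq (can_inj ts)) st.
apply/setP => v; apply/rs_codeP/imsetP => [[g sg ->]|[_ /rs_codeP[f sf ->] ->]].
  exists (\row_i (g \Po (c *: 'X + d%:P)).[u i]).
    apply/rs_codeP; exists (g \Po (c *: 'X + d%:P)) => //.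
    exact: leq_trans (size_comp_affine _ _ _) sg.
  by apply/esym/mulM => i; rewrite horner_comp !hornerE us.
exists (f \Po (c^-1 *: 'X + (- c^-1 * d)%:P)).
  exact: leq_trans (size_comp_affine _ _ _) sf.
apply: mulM => i; rewrite horner_comp !hornerE us mulrDr mulKf //.
by rewrite mulNr addrK.
Qed.

(** The value of [pole_coord beta] at a point other than [beta]; at [beta] itself
the value 0 is a placeholder. *)
Definition point_coord (beta alpha : P1 F) : F :=
  match beta, alpha with
  | None, Some a => a
  | Some b, Some a => (a - b)^-1
  | _, None => 0
  end.

Lemma pole_coord_eval (alpha beta : P1 F) : alpha != beta ->
  pole_coord beta - rat_const (point_coord beta alpha) \in place_ideal (P1_place alpha).
Proof.
case: alpha beta => [a|] [b|] //= ab; first 1 last.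
- exact: P1_place_zero.
- rewrite rmorph0 subr0 place_idealE invrK; apply/andP; split.
    apply/asboolP; exists 1, ('X - b%:P).
    by rewrite polyXsubC_eq0 size_poly1 size_XsubC tofrac1 mul1r rat_x_subC.
  apply/orP; right; apply: contra (rat_x_notin_P1_place_None F) => yO'.
  by rewrite -(subrK (rat_const b) (rat_x F)) rpredD ?rat_const_place_ring.
have ab0 : a - b != 0 by rewrite subr_eq0; apply: contra ab => /eqP->.
have y0 : rat_x F - rat_const b != 0.
  by rewrite -invr_eq0; exact: (pole_coord_neq0 (Some b)).
set y := rat_x F - rat_const b in y0 *.
have e0 : rat_const (a - b) != 0 by rewrite fmorph_eq0.
have -> : y^-1 - rat_const (a - b)^-1 =
    y^-1 * rat_const (a - b)^-1 * (rat_const (a - b) - y).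
  by rewrite fmorphV mulrBr (mulfVK e0) mulrAC (mulVf y0) mul1r.
have -> : rat_const (a - b) - y = - (rat_x F - rat_const a).
  by rewrite rmorphB /= /y !opprB addrA subrK.
apply: place_idealM; last by rewrite rpredN P1_place_zero.
apply: rpredM; last exact: rat_const_place_ring.
apply/asboolP; exists 1, ('X - b%:P).
by rewrite hornerXsubC ab0 /y rat_x_subC tofrac1 mul1r.
Qed.

Lemma AG_code_P1 n (alpha : 'I_n -> P1 F) (beta : P1 F) (r : nat) :
  (forall i, alpha i != beta) ->
  AG_code (fun i => P1_place (alpha i)) << r%:Z *g P1_place beta >> =
  rs_code (fun i => point_coord beta (alpha i)) r.
Proof.
move=> ab; apply/setP => v; rewrite inE.
apply/asboolP/rs_codeP => [[z /riemann_roch_P1[f sf ->] ->]|[f sf ->]].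
  exists f => //; apply/rowP => i; rewrite !mxE.
  by apply: place_eval_horner; exact: pole_coord_eval.
exists (rat_horner f (pole_coord beta)).
  by apply/riemann_roch_P1; exists f.
apply/rowP => i; rewrite !mxE.
by apply/esym/place_eval_horner; exact: pole_coord_eval.
Qed.

End ReedSolomon.

(** * Orbits of affine maps *)

Section AffineOrbits.
Variable K : fieldType.
Implicit Types (a b c d e u x y : K).

Definition affine a b x := a * x + b.

Lemma iter_affine a b k : exists s, forall x, iter k (affine a b) x = a ^+ k * x + s.
Proof.
elim: k => [|k [s IH]]; first by exists 0 => x; rewrite mul1r addr0.
by exists (a * s + b) => x; rewrite /= IH /affine mulrDr mulrA -exprS addrA.
Qed.

(** An iterate that fixes [u] also fixes the image of [u], and an affine map with
two fixed points is the identity. *)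
Lemma iter_affine_id a b u k : affine a b u != u -> iter k (affine a b) u = u ->
  forall x, iter k (affine a b) x = x.
Proof.
move=> Tu ku; have kTu : iter k (affine a b) (affine a b u) = affine a b u.
  by rewrite -iterSr /= ku.
have [s sE] := iter_affine a b k.
rewrite !sE in kTu ku; set v := affine a b u in Tu kTu.
have e : a ^+ k * (v - u) = v - u.
  by rewrite -{2}kTu -{2}ku opprD addrACA subrr addr0 mulrBr.
have /eqP : (a ^+ k - 1) * (v - u) = 0 by rewrite mulrBl e mul1r subrr.
rewrite mulf_eq0 !subr_eq0 (negPf Tu) orbF => /eqP ak.
have s0 : s = 0 by apply: (addrI u); rewrite addr0 -{2}ku ak mul1r.
by move=> x; rewrite sE ak s0 mul1r addr0.
Qed.

Lemma iter_translation b u k : iter k (affine 1 b) u = u + b *+ k.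
Proof.
elim: k => [|k IH] /=; first by rewrite addr0.
by rewrite IH /affine mul1r mulrSr addrA.
Qed.

Lemma iter_homothety a b u k : a != 1 ->
  iter k (affine a b) u = a ^+ k * (u - b / (1 - a)) + b / (1 - a).
Proof.
move=> a1; have a10 : 1 - a != 0 by rewrite subr_eq0 eq_sym.
elim: k => [|k IH] /=; first by rewrite mul1r subrK.
rewrite IH /affine mulrDr mulrA -exprS -addrA; congr (_ + _).
set e := b / (1 - a); have -> : b = e * (1 - a) by rewrite divfK.
by rewrite mulrBr mulr1 [a * e]mulrC addrC subrK.
Qed.

Lemma primitive_root_order n a : (0 < n)%N ->
  (forall k, (a ^+ k == 1) = (n %| k)%N) -> n.-primitive_root a.
Proof.
move=> n0 aP; apply/andP; split=> //; apply/forallP => i.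
rewrite unity_rootE aP; apply/eqP; apply/idP/eqP => [/dvdn_leq le|->//].
by apply/eqP; rewrite eqn_leq ltn_ord le.
Qed.

Lemma homothety_not_center n a b u : (1 < n)%N -> a != 1 ->
  (forall k, (iter k (affine a b) u == u) = (n %| k)%N) -> u - b / (1 - a) != 0.
Proof.
move=> n1 a1 /(_ 1%N); rewrite dvdn1 gtn_eqF // iter_homothety // => uN.
apply: contraFneq uN => ue.
by rewrite ue mulr0 add0r eq_sym -subr_eq0 ue.
Qed.

Lemma homothety_period n a b u : (1 < n)%N -> a != 1 ->
  (forall k, (iter k (affine a b) u == u) = (n %| k)%N) ->
  forall k, (a ^+ k == 1) = (n %| k)%N.
Proof.
move=> n1 a1 uP k; set e := b / (1 - a).
have w0 : u - e != 0 := homothety_not_center n1 a1 uP.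
rewrite -uP iter_homothety // -/e -[RHS](inj_eq (addIr (- e))) addrK.
by rewrite -[X in _ = (_ == X)]mul1r (inj_eq (mulIf w0)).
Qed.

(** A translation moving a point has the characteristic [p] as its period, and in
characteristic [p] the only [p]-th root of unity is 1. *)
Lemma period_linear_part n a b u a' b' u' : (1 < n)%N ->
  (forall k, (iter k (affine a b) u == u) = (n %| k)%N) ->
  (forall k, (iter k (affine a' b') u' == u') = (n %| k)%N) ->
  a = 1 -> a' = 1.
Proof.
move=> n1 + u'P a1; rewrite {a}a1 => uP.
have bP k : (b *+ k == 0) = (n %| k)%N.
  by rewrite -uP iter_translation -[RHS](inj_eq (addrI (- u))) addKr addNr.
have b0 : b != 0 by have := bP 1%N; rewrite mulr1n dvdn1 gtn_eqF // => ->.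
have [||p pF] := @natf0_pchar K n; first exact: ltnW.
  by have : b * n%:R == 0 by [rewrite mulr_natr bP]; rewrite mulf_eq0 (negPf b0).
have pn : p = n.
  have [/primeP[_ pP] _] := andP pF.
  have /pP/pred2P[n1E|->//] : (n %| p)%N by rewrite -bP -mulr_natr pcharf0 // mulr0.
  by rewrite n1E in n1.
apply/eqP; apply: contraT => a'1; have := homothety_period n1 a'1 u'P n.
rewrite dvdnn -pn -(pFrobenius_autE pF) -(rmorph1 (pFrobenius_aut pF)).
by rewrite (inj_eq (fmorph_inj _)) (negPf a'1).
Qed.

(** Both maps are translations or both are homotheties. Two orbits of translations
correspond point by point; for homotheties of ratios [a] and [a'], the
permutation [s] is given by [a ^ i = a' ^ (s i)]. *)
Lemma affine_orbits n a b u a' b' u' : (1 < n)%N ->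
  (forall k, (iter k (affine a b) u == u) = (n %| k)%N) ->
  (forall k, (iter k (affine a' b') u' == u') = (n %| k)%N) ->
  exists (s : 'I_n -> 'I_n) c d, [/\ bijective s, c != 0 &
    forall i, iter (s i) (affine a' b') u' = c * iter i (affine a b) u + d].
Proof.
move=> n1 uP u'P.
have [a1|a1] := eqVneq a 1.
  have a'1 := period_linear_part n1 uP u'P a1; subst a a'.
  have tP v w : (forall k, (iter k (affine 1 v) w == w) = (n %| k)%N) -> v != 0.
    move=> /(_ 1%N); rewrite iter_translation -[w in _ == w]addr0 (inj_eq (addrI w)) dvdn1.
    by rewrite gtn_eqF // => ->.
  have b0 := tP _ _ uP; have b'0 := tP _ _ u'P.
  exists id, (b' / b), (u' - b' / b * u); split; first by exists id.
    by rewrite mulf_neq0 ?invr_eq0.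
  move=> i; rewrite !iter_translation mulrDr mulrnAr divfK //.
  by rewrite [RHS]addrC addrA subrK.
have a'1 : a' != 1 by apply: contra_neq a1; exact: period_linear_part n1 u'P uP.
have aP := homothety_period n1 a1 uP; have a'P := homothety_period n1 a'1 u'P.
have aR := primitive_root_order (ltnW n1) aP.
have a'R := primitive_root_order (ltnW n1) a'P.
have [s sE] : exists s : 'I_n -> 'I_n, forall i : 'I_n, a ^+ i = a' ^+ s i.
  have aX i : (a ^+ i) ^+ n = 1 by rewrite exprAC (prim_expr_order aR) expr1n.
  by exists (fun i : 'I_n => sval (prim_rootP a'R (aX i))) => i; case: (prim_rootP _ _).
have s_inj : injective s.
  move=> i j ij; apply/val_inj/eqP.
  have : a ^+ i == a ^+ j by rewrite !sE ij.
  by rewrite (eq_prim_root_expr aR) !modn_small.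
set e := b / (1 - a); set e' := b' / (1 - a').
have w0 : u - e != 0 := homothety_not_center n1 a1 uP.
have w'0 : u' - e' != 0 := homothety_not_center n1 a'1 u'P.
(* This affine map sends the fixed point [e] to [e'] and [u] to [u']. *)
exists s, ((u' - e') / (u - e)), (e' - (u' - e') / (u - e) * e).
split; [exact: injF_bij | by rewrite mulf_neq0 ?invr_eq0 |] => i.
rewrite !iter_homothety // -/e -/e' -sE [in RHS]mulrDr.
by rewrite addrACA subrr addr0 mulrCA divfK.
Qed.

(** If [T^i u = T^j u] with [i <= j < n], applying [T^(n - j)] shows that
[n - (j - i)] is a period, so that [i = j]. *)
Lemma affine_orbit_inj n a b u :
  (forall k, (iter k (affine a b) u == u) = (n %| k)%N) ->
  injective (fun i : 'I_n => iter i (affine a b) u).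
Proof.
move=> uP; suff le_inj (i j : 'I_n) : (i <= j)%N ->
    iter i (affine a b) u = iter j (affine a b) u -> i = j.
  move=> i j e; have [le|/ltnW le] := leqP i j; first exact: le_inj le e.
  exact/esym/(le_inj _ _ le).
move=> ij e; have ltjn := ltn_ord j.
have /dvdn_leq : (n %| n - j + i)%N.
  by rewrite -uP iterD e -iterD subnK ?uP ?dvdnn // ltnW.
rewrite addn_gt0 subn_gt0 ltjn => /(_ isT) le; apply/val_inj/eqP.
by rewrite eqn_leq ij -(leq_add2l (n - j)) subnK // ltnW.
Qed.

End AffineOrbits.

(** * Fractional linear transformations as affine maps *)

Section ProjectiveLine.
Variable F : finFieldType.
Implicit Types (M N : 'M[F]_2) (alpha beta : P1 F) (A B : PGL2 F).

(** Homogeneous coordinates. They turn identities between fractional linear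
transformations into matrix identities, up to a scalar. *)
Definition hvec alpha : 'cV[F]_2 :=
  \col_i (if alpha is Some x then (if i == 0 then x else 1) else (i == 0)%:R).

Lemma mx2_mulE M (v : 'cV[F]_2) i : (M *m v) i 0 = M i 0 * v 0 0 + M i 1 * v 1 0.
Proof.
rewrite mxE !big_ord_recl big_ord0 addr0; congr (_ + _ * _); congr (_ _ _);
  exact: val_inj.
Qed.

Lemma ord2_ind (Q : 'I_2 -> Prop) : Q 0 -> Q 1 -> forall i, Q i.
Proof.
move=> Q0 Q1 -[[|[|//]] lti].
  by rewrite (_ : Ordinal lti = 0) //; apply: val_inj.
by rewrite (_ : Ordinal lti = 1) //; apply: val_inj.
Qed.

Lemma cV2P (v w : 'cV[F]_2) : v 0 0 = w 0 0 -> v 1 0 = w 1 0 -> v = w.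
Proof. by move=> e0 e1; apply/colP; apply: ord2_ind. Qed.

Lemma hvec_neq0 alpha : hvec alpha != 0.
Proof.
apply/eqP; case: alpha => [x|] /matrixP.
  by move=> /(_ 1 0)/eqP; rewrite !mxE oner_eq0.
by move=> /(_ 0 0)/eqP; rewrite !mxE eqxx oner_eq0.
Qed.

Lemma hvec_inj c alpha beta : c *: hvec alpha = hvec beta -> alpha = beta.
Proof.
case: alpha beta => [x|] [y|] // /matrixP e; have := e 0 0; have := e 1 0.
all: rewrite !mxE /= ?mulr1 ?mulr0.
- by move=> ->; rewrite mul1r => ->.
- by move=> -> /eqP; rewrite mul0r eq_sym oner_eq0.
- by move=> /eqP; rewrite eq_sym oner_eq0.
Qed.

Lemma moebius_hvec M alpha : M \in unitmx ->
  exists2 c, c != 0 & M *m hvec alpha = c *: hvec (moebius M alpha).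
Proof.
move=> MU; suff [c e] : exists c, M *m hvec alpha = c *: hvec (moebius M alpha).
  exists c => //; apply: contraNneq (hvec_neq0 alpha) => c0.
  by rewrite -(mulKmx MU (hvec alpha)) e c0 scale0r mulmx0.
case: alpha => [x|] /=; [have [d0|d0] := eqVneq (M 1 0 * x + M 1 1) 0 |
  have [d0|d0] := eqVneq (M 1 0) 0].
- exists (M 0 0 * x + M 0 1).
  by apply: cV2P; rewrite mx2_mulE !mxE /= !mulr1 ?d0 ?mulr0.
- exists (M 1 0 * x + M 1 1).
  by apply: cV2P; rewrite mx2_mulE !mxE /= !mulr1 // [RHS]mulrC divfK.
- exists (M 0 0).
  by apply: cV2P; rewrite mx2_mulE !mxE /= !mulr0 !mulr1 ?d0 !addr0.
- exists (M 1 0).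
  by apply: cV2P; rewrite mx2_mulE !mxE /= !mulr0 !mulr1 !addr0 // [RHS]mulrC divfK.
Qed.

Lemma moebiusM M N alpha : M \in unitmx -> N \in unitmx ->
  moebius (M *m N) alpha = moebius M (moebius N alpha).
Proof.
move=> MU NU; have MNU : M *m N \in unitmx by rewrite unitmx_mul MU.
have [c c0 e] := moebius_hvec alpha MNU; have [d d0 e'] := moebius_hvec alpha NU.
have [k k0 e''] := moebius_hvec (moebius N alpha) MU.
apply: (@hvec_inj ((d * k)^-1 * c)).
rewrite -scalerA -e -mulmxA e' -scalemxAr e'' [d *: _]scalerA scalerA mulVf ?scale1r //.
by rewrite mulf_neq0.
Qed.

Lemma moebius1 alpha : moebius 1%:M alpha = alpha.
Proof.
by case: alpha => [x|]; rewrite /moebius !mxE /= ?mul0r ?add0r ?oner_eq0 ?eqxx //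
  mul1r addr0 divr1.
Qed.

Lemma moebius_inj M : M \in unitmx -> injective (moebius M).
Proof.
move=> MU; apply: (@can_inj _ _ _ (moebius (invmx M))) => alpha.
by rewrite -moebiusM ?unitmx_inv // mulVmx // moebius1.
Qed.

Lemma PGL2_repr A : coset 'Z('GL_2[F])%g (repr A) = A.
Proof. exact: coset_reprK. Qed.

Lemma PGL2_act1 alpha : PGL2_act (1%g : PGL2 F) alpha = alpha.
Proof. by rewrite -(morph1 (coset_morphism _)) PGL2_actE moebius1. Qed.

Lemma norm_center_GL2 (g : {'GL_2[F]}) : g \in 'N('Z('GL_2[F]))%g.
Proof.
by have /fintype.subsetP := normal_norm (center_normal 'GL_2[F]); apply; rewrite inE.
Qed.

Lemma PGL2_actM A B alpha : PGL2_act (A * B)%g alpha = PGL2_act A (PGL2_act B alpha).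
Proof.
rewrite -[A]PGL2_repr -[B]PGL2_repr -coset_morphM ?norm_center_GL2 //.
rewrite !PGL2_actE GL_MxE moebiusM; [by []|exact: (GL_unitmx (repr A))|exact: (GL_unitmx (repr B))].
Qed.

Lemma PGL2_actX A k alpha : PGL2_act (A ^+ k)%g alpha = iter k (PGL2_act A) alpha.
Proof.
by elim: k => [|k IH] /=; rewrite ?expg0 ?PGL2_act1 // expgS PGL2_actM IH.
Qed.

(** Fixing infinity, 0 and 1 is enough. *)
Lemma moebius_id_scalar M : (forall alpha, moebius M alpha = alpha) ->
  M = (M 0 0)%:M.
Proof.
move=> Mid.
have := Mid None; rewrite /moebius; case: eqVneq => // M10 _.
have := Mid (Some 0); rewrite /moebius M10 !mulr0 !add0r; case: eqVneq => // M11 [].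
move=> /eqP; rewrite mulf_eq0 invr_eq0 (negPf M11) orbF => /eqP M01.
have := Mid (Some 1); rewrite /moebius M10 M01 !mulr1 add0r addr0 (negPf M11) => -[].
move=> /(congr1 (fun x => x * M 1 1)); rewrite divfK // mul1r => M00.
apply/matrixP; apply: ord2_ind; apply: ord2_ind; rewrite !mxE ?M01 ?M10 ?M00 //.
Qed.

Lemma PGL2_act_faithful A : (forall alpha, PGL2_act A alpha = alpha) -> A = 1%g.
Proof.
move=> Aid; rewrite -[A]PGL2_repr; apply: coset_id.
have gE := @moebius_id_scalar (GLval (repr A)) Aid.
apply/centerP; split=> [|y _]; first by rewrite inE.
apply: val_inj; change (GLval (repr A * y)%g = GLval (y * repr A)%g).
by rewrite !GL_MxE gE scalar_mxC.
Qed.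

(** The transformation [x |-> 1 / (x - b)], or the identity if [beta] is
infinite: the matrix form of [pole_coord beta], moving [beta] to infinity. *)
Definition pole_mx beta : 'M[F]_2 :=
  if beta is Some b then \matrix_(i, j) (if i == 0 then (j != 0)%:R else if j == 0 then 1 else - b)
  else 1%:M.

Lemma pole_mx_unit beta : pole_mx beta \in unitmx.
Proof.
case: beta => [b|] /=; last exact: unitmx1.
pose J : 'M[F]_2 := \matrix_(i, j) (if j == 0 then (if i == 0 then b else 1) else (i == 0)%:R).
(* [J] represents [x |-> b + 1 / x], the inverse transformation. *)
suff /mulmx1_unit[] : pole_mx (Some b) *m J = 1%:M by [].
apply/matrixP; apply: ord2_ind; apply: ord2_ind; rewrite !mxE !big_ord_recl big_ord0 !mxE /=.
all: by rewrite ?mul0r ?mul1r ?mulr0 ?mulr1 ?addr0 ?add0r ?subrr.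
Qed.

Lemma moebius_pole_mx beta alpha :
  moebius (pole_mx beta) alpha = if alpha == beta then None else Some (point_coord beta alpha).
Proof.
case: beta alpha => [b|] [a|]; rewrite /pole_mx ?moebius1 // /moebius !mxE /=.
- rewrite mul1r subr_eq0; change (Some a == Some b) with (a == b); case: eqVneq => // _.
  by rewrite mul0r add0r mul1r.
- by rewrite oner_eq0 mul0r.
Qed.

(** Conjugation by [pole_mx beta] turns [A] into a transformation fixing
infinity, that is, a triangular matrix acting on the field as an affine map. *)
Lemma PGL2_act_affine A beta : PGL2_act A beta = beta ->
  exists a b, forall alpha, alpha != beta -> PGL2_act A alpha != beta /\
    point_coord beta (PGL2_act A alpha) = affine a b (point_coord beta alpha).
Proof.
move=> Ab; pose M := GLval (repr A); have MU : M \in unitmx := GL_unitmx (repr A).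
pose J := pole_mx beta; have JU : J \in unitmx := pole_mx_unit beta.
pose N := J *m M *m invmx J.
have NE alpha : moebius N (moebius J alpha) = moebius J (moebius M alpha).
  have NU : N \in unitmx by rewrite !unitmx_mul unitmx_inv JU MU.
  by rewrite -!moebiusM // mulmxKV.
have Jb : moebius J beta = None by rewrite moebius_pole_mx eqxx.
have N10 : N 1 0 = 0.
  have := NE beta; rewrite Jb [moebius M beta]Ab Jb /moebius.
  by case: eqVneq.
exists (N 0 0 / N 1 1), (N 0 1 / N 1 1) => alpha ab.
have Mab : moebius M alpha != beta.
  by apply: contra ab => /eqP Mab; rewrite -(inj_eq (moebius_inj MU)) Mab eq_sym [moebius M beta]Ab.
split=> //; have := NE alpha; rewrite !moebius_pole_mx (negPf ab) (negPf Mab).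
rewrite /moebius N10 mul0r add0r; case: eqVneq => // _ [].
by rewrite /affine mulrDl mulrAC => <-.
Qed.

Lemma point_coord_inj beta alpha alpha' : alpha != beta -> alpha' != beta ->
  point_coord beta alpha = point_coord beta alpha' -> alpha = alpha'.
Proof.
move=> ab a'b e; apply: (moebius_inj (pole_mx_unit beta)).
by rewrite !moebius_pole_mx (negPf ab) (negPf a'b) e.
Qed.

(** If the [k]-th iterate of the affine map fixes the coordinate of the moved
point [alpha], it is the identity by [iter_affine_id], so [A ^ k] acts
trivially on the projective line and equals 1. *)
Lemma PGL2_orbit A alpha beta : PGL2_act A alpha <> alpha -> PGL2_act A beta = beta ->
  exists a b, [/\ forall k, iter k (PGL2_act A) alpha != beta,
    forall k, point_coord beta (iter k (PGL2_act A) alpha) =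
              iter k (affine a b) (point_coord beta alpha) &
    forall k, (iter k (affine a b) (point_coord beta alpha) == point_coord beta alpha)
       = (#[A]%g %| k)%N].
Proof.
move=> Aa Ab; have [a [b abP]] := PGL2_act_affine Ab.
have iterP al : al != beta -> forall k, iter k (PGL2_act A) al != beta /\
    point_coord beta (iter k (PGL2_act A) al) = iter k (affine a b) (point_coord beta al).
  move=> alb; elim=> [|k [IH1 IH2]] //=.
  by have [? ->] := abP _ IH1; rewrite IH2.
have alb : alpha != beta by apply: contra_notN Aa => /eqP->.
exists a, b; split=> k; [exact: (iterP _ alb k).1 | exact: (iterP _ alb k).2 |].
rewrite order_dvdn; apply/eqP/eqP => [ku|Ak]; last first.
  by rewrite -(iterP _ alb k).2 -PGL2_actX Ak PGL2_act1.
apply: PGL2_act_faithful => al; rewrite PGL2_actX.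
have [->|nalb] := eqVneq al beta; first by elim: k {ku} => //= k ->.
apply: (@point_coord_inj beta) => //; first exact: (iterP _ nalb k).1.
rewrite (iterP _ nalb k).2; apply: iter_affine_id ku _.
have /= [Aab <-] := iterP _ alb 1%N; apply/eqP => /point_coord_inj e; apply: Aa; exact: e.
Qed.

Lemma sigma_cyclic_codeE A alpha beta r :
  PGL2_act A^-1%g alpha <> alpha -> PGL2_act A^-1%g beta = beta ->
  exists a b u, (forall k, (iter k (affine a b) u == u) = (#[A]%g %| k)%N) /\
    sigma_cyclic_code A alpha beta r =
      rs_code (fun i : 'I_(#[A]%g) => iter i (affine a b) u) r.
Proof.
move=> Aa Ab; have [a [b [ab uE uP]]] := PGL2_orbit Aa Ab.
exists a, b, (point_coord beta alpha); split; first by move=> k; rewrite uP orderV.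
rewrite /sigma_cyclic_code AG_code_P1 => [|i]; last exact: ab.
by congr rs_code; apply: funext => i; rewrite uE.
Qed.

End ProjectiveLine.

Theorem theorem4p14 (F : finFieldType) (A A' : PGL2 F)
    (alpha beta alpha' beta' : P1 F) (r r' : nat)
    (halpha : PGL2_act A^-1%g alpha <> alpha)
    (hbeta : PGL2_act A^-1%g beta = beta)
    (halpha' : PGL2_act A'^-1%g alpha' <> alpha')
    (hbeta' : PGL2_act A'^-1%g beta' = beta')
    (hr : (1 <= r <= #[A]%g - 2)%N)
    (hr' : (1 <= r' <= #[A']%g - 2)%N)
    (hlength : #[A]%g = #[A']%g)
    (hdim : code_dim (sigma_cyclic_code A alpha beta r) =
            code_dim (sigma_cyclic_code A' alpha' beta' r')) :
  code_equiv (sigma_cyclic_code A alpha beta r)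
             (sigma_cyclic_code A' alpha' beta' r').
Proof.
have ltr n k : (1 <= k <= n - 2)%N -> (k < n)%N.
  case/andP=> k0 kn; have := leq_trans k0 kn; rewrite subn_gt0 => n2.
  by rewrite (leq_ltn_trans kn) // ltn_subrL (ltnW (ltnW n2)).
have [a [b [u [uP CE]]]] := sigma_cyclic_codeE r halpha hbeta.
have [a' [b' [u' [u'P CE']]]] := sigma_cyclic_codeE r' halpha' hbeta'.
rewrite CE CE' in hdim *; have [rn r'n] := (ltr _ _ hr, ltr _ _ hr').
move: hdim; rewrite !dim_rs_code //; [|exact: affine_orbit_inj..].
move=> [rr']; rewrite -{}rr' {r' hr' r'n CE'}.
have n1 : (1 < #[A]%g)%N by apply: leq_ltn_trans rn; case/andP: hr.
rewrite {}hlength in rn n1 uP *.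
have [s [c [d [sB c0 sE]]]] := affine_orbits n1 uP u'P.
exact: rs_code_equiv sB c0 sE.
Qed.
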